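(* For a metric space $(X,d)$, the following statements are equivalent: (1) $X$ is ultrametric. (2) $X$ has strict $p$-negative type for all $p \ge 0$. (3) $X$ admits no $p$-polygonal equality for any $p \ge 0$.
   Context: A metric space $(X,d)$ is ultrametric if $d(x,y) \le \max\{d(x,z), d(y,z)\}$ for all $x,y,z \in X$. Let $p \ge 0$; distances raised to the power $p=0$ use the convention $0^0 = 0$. $(X,d)$ has $p$-negative type if for all finite subsets $\{x_1, \ldots, x_n\} \subseteq X$ (with $x_1,\ldots,x_n$ distinct) and all real numbers $\eta_1, \ldots, \eta_n$ with $\eta_1 + \cdots + \eta_n = 0$ we have $\sum_{1 \le i,j \le n} d(x_i,x_j)^p \eta_i \eta_j \le 0$. It has strict $p$-negative type if it has $p$-negative type and this inequality is strict whenever $(\eta_1, \ldots, \eta_n) \ne (0, \ldots, 0)$. A $p$-polygonal equality in $(X,d)$ is an equality $$\sum_{1 \le j_1 < j_2 \le s} m_{j_1} m_{j_2} d(a_{j_1},a_{j_2})^p + \sum_{1 \le i_1 < i_2 \le t} n_{i_1} n_{i_2} d(b_{i_1},b_{i_2})^p = \sum_{j=1}^{s} \sum_{i=1}^{t} m_j n_i d(a_j,b_i)^p,$$ where $s,t \ge 1$ are integers, $a_1, \ldots, a_s, b_1, \ldots, b_t \in X$ are pairwise distinct points, and $m_1, \ldots, m_s, n_1, \ldots, n_t > 0$ are real numbers with $m_1 + \cdots + m_s = n_1 + \cdots + n_t$. *)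

(* Defs.v *)
From mathcomp Require Import all_boot all_order all_algebra.
From mathcomp Require Import all_classical all_reals all_analysis.

Set Implicit Arguments.
Unset Strict Implicit.
Unset Printing Implicit Defensive.
Import Order.TTheory GRing.Theory Num.Theory.

Local Open Scope ring_scope.

Definition ultrametric (R : realType) (X : metricType R) : Prop :=
  forall x y z : X, mdist x y <= Num.max (mdist x z) (mdist y z).

(* The library's [powR] has 0 `^ 0 = 1, whereas negative type and polygonal
   equalities for p = 0 use the convention 0 ^ 0 = 0. *)
Definition dist_pow (R : realType) (X : metricType R) (p : R) (x y : X) : R :=
  if (mdist x y == 0) && (p == 0) then 0 else mdist x y `^ p.

(* A finite subset {x_1, ..., x_n} is given by an injective enumeration. *)
Definition negative_type (R : realType) (X : metricType R) (p : R) : Prop :=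
  forall (n : nat) (x : 'I_n -> X) (eta : 'I_n -> R),
    injective x -> \sum_(i < n) eta i = 0 ->
    \sum_(i < n) \sum_(j < n) dist_pow p (x i) (x j) * eta i * eta j <= 0.

Definition strict_negative_type (R : realType) (X : metricType R) (p : R)
    : Prop :=
  negative_type X p /\
  forall (n : nat) (x : 'I_n -> X) (eta : 'I_n -> R),
    injective x -> \sum_(i < n) eta i = 0 -> (exists i, eta i != 0) ->
    \sum_(i < n) \sum_(j < n) dist_pow p (x i) (x j) * eta i * eta j < 0.

Definition polygonal_equality (R : realType) (X : metricType R) (p : R)
    (s t : nat) (a : 'I_s -> X) (b : 'I_t -> X) (m : 'I_s -> R) (n : 'I_t -> R)
    : Prop :=
  [/\ (1 <= s)%N /\ (1 <= t)%N,
      [/\ injective a, injective b & forall j i, a j != b i],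
      (forall j, 0 < m j) /\ (forall i, 0 < n i),
      \sum_(j < s) m j = \sum_(i < t) n i &
      \sum_(j1 < s) \sum_(j2 < s | (j1 < j2)%N)
          m j1 * m j2 * dist_pow p (a j1) (a j2) +
      \sum_(i1 < t) \sum_(i2 < t | (i1 < i2)%N)
          n i1 * n i2 * dist_pow p (b i1) (b i2) =
      \sum_(j < s) \sum_(i < t) m j * n i * dist_pow p (a j) (b i)].

Definition admits_polygonal_equality (R : realType) (X : metricType R) (p : R)
    : Prop :=
  exists (s t : nat) (a : 'I_s -> X) (b : 'I_t -> X)
         (m : 'I_s -> R) (n : 'I_t -> R), polygonal_equality p a b m n.

(* Main.v *)
Require Import Defs.
From mathcomp Require Import all_boot all_order all_algebra.
From mathcomp Require Import all_classical all_reals all_analysis.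
From mathcomp Require Import ring lra.

Import Order.TTheory GRing.Theory Num.Theory numFieldNormedType.Exports.

Set Implicit Arguments.
Unset Strict Implicit.
Unset Printing Implicit Defensive.

(** Ultrametric implies strict negative type. If [d] is an ultrametric, so is
   [d ^ p] for every [p >= 0] (for [p = 0] it is the discrete metric), so it
   is enough to treat the form [\sum_(i, j) D i j * e i * e j] of a finite
   ultrametric [D] on the vectors [e] of sum zero. Let [m] be the least nonzero
   value of [D]. Then [D] is [m] times the indicator of [D i j != 0], plus
   [max (D - m) 0]. By the ultrametric inequality [D i j = 0] is an equivalence
   relation; since [e] has sum zero, the indicator contributes minus the sum,
   over the classes, of the squared mass of the class ([qform_peel]). The
   remainder [max (D - m) 0] again satisfies the ultrametric inequality and
   vanishes at more pairs, so induction shows that the form is nonpositive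
   ([ultrametric_qform_le0]). If distinct points are at nonzero distance, the
   classes of the first step are singletons, and that step contributes
   [- m * \sum_i e i ^+ 2 < 0] ([ultrametric_qform_lt0]).

   Strict negative type excludes polygonal equalities: with the weights [m] on
   the points [a] and [- n] on the points [b], the form is twice the difference
   of the two sides of the equality.

   Without polygonal equalities the space is ultrametric: if
   [d x y > max (d x z) (d y z)], then for a large integer exponent [p] the term
   [d x y ^ p] dwarfs the other two. Balance the single point [z] of weight [1]
   against [x] and [y] with weights [w] and [1 - w]. At [w = 0] the side with
   [z] is larger, at [w = 1 / 2] the other side is; at a value in between the
   two sides agree ([balancing_weight]), which is a polygonal equality. *)

Local Open Scope ring_scope.

(** * Quadratic forms of finite ultrametrics *)

(** Distinct points may be at distance zero: subtracting the least nonzero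
   value from an ultrametric merges points, and the induction needs a notion
   that survives this. *)
Definition ultrametric_kernel {F : realDomainType} {I : Type} (D : I -> I -> F)
    : Prop :=
  [/\ forall i, D i i = 0, forall i j, D i j = D j i &
      forall i j k, D i j <= Num.max (D i k) (D j k)].

Definition qform {F : pzRingType} {I : finType} (D : I -> I -> F) (e : I -> F)
    : F :=
  \sum_i \sum_j D i j * e i * e j.

Definition zero_class {F : realDomainType} {I : finType} (D : I -> I -> F)
    (i : I) : {set I} :=
  [set j | D i j == 0]%SET.

Lemma ultrametric_kernel_ge0 (F : realDomainType) (I : Type) (D : I -> I -> F)
    (i j : I) :
  ultrametric_kernel D -> 0 <= D i j.
Proof. by case=> D0 _ /(_ i i j); rewrite D0 maxxx. Qed.

Lemma ultrametric_kernel_cut (F : realDomainType) (I : Type) (D : I -> I -> F)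
    (m : F) :
  0 <= m -> ultrametric_kernel D ->
  ultrametric_kernel (fun i j => Num.max (D i j - m) 0).
Proof.
move=> m0 [D0 Dsym Dmax]; split=> [i | i j | i j k].
- by rewrite D0 sub0r; apply/max_idPr; rewrite oppr_le0.
- by rewrite Dsym.
- have := Dmax i j k; rewrite ge_max !le_max !lerD2r lexx !orbT andbT.
  by case/orP=> ->; rewrite ?orbT.
Qed.

(** The ultrametric inequality is what makes [D i j = 0] transitive. *)
Lemma zero_class_eq (F : realDomainType) (I : finType) (D : I -> I -> F)
    (i j : I) :
  ultrametric_kernel D -> (zero_class D i == zero_class D j) = (D i j == 0).
Proof.
move=> uD; have [D0 Dsym Dmax] := uD; apply/eqP/idP => [/setP/(_ j) | Dij].
  by rewrite !inE D0 eqxx.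
apply/setP=> k; rewrite !inE !eq_le !(ultrametric_kernel_ge0 _ _ uD).
rewrite !andbT; apply/idP/idP => Dk.
- by apply: le_trans (Dmax j k i) _; rewrite Dsym (eqP Dij) ge_max lexx Dsym.
- by apply: le_trans (Dmax i k j) _; rewrite (eqP Dij) ge_max lexx Dsym.
Qed.

(** The indicator of an equivalence relation, given as the kernel of a map [c],
   has as its form a sum of squares, one for each class. *)
Lemma qform_fibers (F : comPzRingType) (I K : finType) (c : I -> K)
    (e : I -> F) :
  qform (fun i j => (c i == c j)%:R) e =
  \sum_(k : K) (\sum_(i | c i == k) e i) ^+ 2.
Proof.
rewrite /qform (partition_big c xpredT) //=; apply: eq_bigr => k _.
rewrite expr2 mulr_suml; apply: eq_bigr => i /eqP ci.
rewrite mulr_sumr [RHS]big_mkcond; apply: eq_bigr => j _ /=.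
by rewrite ci eq_sym; case: (_ == _); rewrite ?mul1r ?mul0r.
Qed.

(** Lowering [D] by [m] outside of its zero set subtracts [m] times the
   indicator of [D i j != 0]. This indicator is [1] minus the indicator of an
   equivalence relation, and the form of the constant [1] is the square of
   [\sum_i e i], hence zero. *)
Lemma qform_peel (F : realDomainType) (I : finType) (D : I -> I -> F) (m : F)
    (e : I -> F) :
  ultrametric_kernel D -> (forall i j, D i j != 0 -> m <= D i j) -> 0 <= m ->
  \sum_i e i = 0 ->
  qform D e = qform (fun i j => Num.max (D i j - m) 0) e
    - m * \sum_(B : {set I}) (\sum_(i | zero_class D i == B) e i) ^+ 2.
Proof.
move=> uD mD m0 e0; rewrite -qform_fibers.
have -> : qform D e = qform (fun i j => Num.max (D i j - m) 0) e
    + m * ((\sum_i e i) * \sum_j e j)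
    - m * qform (fun i j => (zero_class D i == zero_class D j)%:R) e.
  rewrite /qform mulr_suml !mulr_sumr -big_split -sumrB; apply: eq_bigr => i _.
  rewrite /= !mulr_sumr -big_split -sumrB; apply: eq_bigr => j _ /=.
  rewrite zero_class_eq //; have [Dij | /mD le_mD] := eqVneq (D i j) 0.
    by rewrite Dij sub0r (max_idPr _) ?oppr_le0 //=; ring.
  by rewrite (max_idPl _) ?subr_ge0 //=; ring.
by rewrite e0 !mul0r mulr0 addr0.
Qed.

Lemma least_nonzero_value (F : realDomainType) (I : finType) (D : I -> I -> F)
    (i0 j0 : I) :
  ultrametric_kernel D -> D i0 j0 != 0 ->
  exists i j, 0 < D i j /\ forall i' j', D i' j' != 0 -> D i j <= D i' j'.
Proof.
move=> uD nz.
case: (@arg_minP _ _ _ (i0, j0) (fun u : I * I => D u.1 u.2 != 0)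
  (fun u => D u.1 u.2) nz) => -[i j] /= Dij Dmin.
exists i, j; split; last by move=> i' j' /(Dmin (i', j')).
by rewrite lt_neqAle eq_sym Dij (ultrametric_kernel_ge0 _ _ uD).
Qed.

(** Induction on the number of pairs at nonzero distance, which decreases when
   the least nonzero value is subtracted. *)
Lemma ultrametric_qform_le0 (F : realDomainType) (I : finType)
    (D : I -> I -> F) (e : I -> F) :
  ultrametric_kernel D -> \sum_i e i = 0 -> qform D e <= 0.
Proof.
move=> + e0; have [n] := ubnP #|[set u : I * I | D u.1 u.2 != 0]%SET|.
elim: n D => // n IHn D ltDn uD.
have [/existsP[i0 /existsP[j0 nz]] | /existsPn Dz] :=
    boolP [exists i, exists j, D i j != 0]; last first.
  rewrite /qform big1 // => i _; rewrite big1 // => j _.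
  by have /existsPn/(_ j)/negPn/eqP-> := Dz i; rewrite !mul0r.
have [i [j [Dij0 Dmin]]] := least_nonzero_value uD nz.
rewrite (qform_peel uD Dmin (ltW Dij0) e0) subr_le0.
apply: (@le_trans _ _ 0); last first.
  by rewrite mulr_ge0 ?(ltW Dij0) // sumr_ge0 // => B _; rewrite sqr_ge0.
apply: IHn; last exact: ultrametric_kernel_cut (ltW Dij0) uD.
move: ltDn; rewrite ltnS; apply: leq_trans.
apply/proper_card/properP; split.
  apply/fintype.subsetP=> -[k l]; rewrite !inE /=; apply: contra_neq => ->.
  by rewrite sub0r (max_idPr _) // oppr_le0 ltW.
by exists (i, j); rewrite !inE /= ?subrr ?maxxx ?eqxx // gt_eqF.
Qed.

(** When distinct points are at nonzero distance, the first subtraction step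
   already gives a negative term: the class of [i0] is [i0] alone, so its mass
   is [e i0 != 0]. *)
Lemma ultrametric_qform_lt0 (F : realDomainType) (I : finType)
    (D : I -> I -> F) (e : I -> F) (i0 : I) :
  ultrametric_kernel D -> (forall i j, D i j = 0 -> i = j) ->
  \sum_i e i = 0 -> e i0 != 0 -> qform D e < 0.
Proof.
move=> uD Dinj e0 ei0.
have [j0 nz] : exists j, D i0 j != 0.
  apply/existsP; apply: contra_neqT ei0 => /existsPn Dz; rewrite -[RHS]e0.
  rewrite (bigD1 i0) //= big1 ?addr0 // => j.
  by rewrite eq_sym => /eqP; case; apply/Dinj/eqP; have /negPn := Dz j.
have [i [j [Dij0 Dmin]]] := least_nonzero_value uD nz.
rewrite (qform_peel uD Dmin (ltW Dij0) e0) subr_lt0.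
apply: (@le_lt_trans _ _ 0).
  exact/ultrametric_qform_le0/e0/ultrametric_kernel_cut/uD/ltW.
rewrite mulr_gt0 // (bigD1 (zero_class D i0)) //=.
apply: ltr_pwDl; last by rewrite sumr_ge0 // => B _; rewrite sqr_ge0.
rewrite (big_pred1 i0) ?exprn_even_gt0 //= => k.
rewrite zero_class_eq //; apply/eqP/eqP => [/Dinj // | ->].
by case: uD.
Qed.

(** * From ultrametric to strict negative type *)

Lemma dist_powxx (R : realType) (X : metricType R) (p : R) (x : X) :
  dist_pow p x x = 0.
Proof.
by rewrite /dist_pow mdistxx eqxx /=; case: eqVneq => // /powR0.
Qed.

Lemma dist_powC (R : realType) (X : metricType R) (p : R) (x y : X) :
  dist_pow p x y = dist_pow p y x.
Proof. by rewrite /dist_pow metric_sym. Qed.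

Lemma dist_powE (R : realType) (X : metricType R) (p : R) (x y : X) :
  x != y -> dist_pow p x y = mdist x y `^ p.
Proof. by rewrite /dist_pow -mdist_gt0 => /gt_eqF->. Qed.

Lemma dist_pow_eq0 (R : realType) (X : metricType R) (p : R) (x y : X) :
  dist_pow p x y = 0 -> x = y.
Proof.
have [//|ne] := eqVneq x y; rewrite dist_powE // => /eqP.
by rewrite gt_eqF // powR_gt0 // mdist_gt0.
Qed.

Lemma dist_pow_ge0 (R : realType) (X : metricType R) (p : R) (x y : X) :
  0 <= dist_pow p x y.
Proof. by rewrite /dist_pow; case: ifP => // _; rewrite powR_ge0. Qed.

(** Also true for [p = 0], thanks to the convention [0 ^ 0 = 0]: a positive
   distance cannot lie below a zero one. *)
Lemma ler_dist_pow (R : realType) (X : metricType R) (p : R) (x y z t : X) :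
  0 <= p -> mdist x y <= mdist z t -> dist_pow p x y <= dist_pow p z t.
Proof.
move=> p0 le_d; have [->|xy] := eqVneq x y.
  by rewrite dist_powxx dist_pow_ge0.
have zt : z != t by rewrite -mdist_gt0 (lt_le_trans _ le_d) ?mdist_gt0.
by rewrite !dist_powE // ge0_ler_powR // nnegrE mdist_ge0.
Qed.

Lemma ultrametric_kernel_dist_pow (R : realType) (X : metricType R) (p : R)
    (I : Type) (x : I -> X) :
  ultrametric X -> 0 <= p ->
  ultrametric_kernel (fun i j => dist_pow p (x i) (x j)).
Proof.
move=> uX p0; split=> [i | i j | i j k].
- exact: dist_powxx.
- exact: dist_powC.
- have := uX (x i) (x j) (x k); rewrite !le_max.
  by case/orP=> /(ler_dist_pow p0)->; rewrite ?orbT.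
Qed.

Lemma ultrametric_strict_negative_type (R : realType) (X : metricType R)
    (p : R) :
  ultrametric X -> 0 <= p -> strict_negative_type X p.
Proof.
move=> uX p0; split=> [n x e xinj e0 | n x e xinj e0 [i0 ei0]].
  exact/ultrametric_qform_le0/e0/ultrametric_kernel_dist_pow.
apply: ultrametric_qform_lt0 e0 ei0; first exact: ultrametric_kernel_dist_pow.
by move=> i j /dist_pow_eq0/xinj.
Qed.

(** * From strict negative type to the absence of polygonal equalities *)

Lemma sum_sym_offdiag (F : pzRingType) (s : nat) (f : 'I_s -> 'I_s -> F) :
  (forall i j, f i j = f j i) -> (forall i, f i i = 0) ->
  \sum_i \sum_j f i j = (\sum_(i < s) \sum_(j < s | (i < j)%N) f i j) *+ 2.
Proof.
move=> fC f0.
transitivity (\sum_(i < s) \sum_(j < s | (i < j)%N) f i j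
              + \sum_(i < s) \sum_(j < s | (j < i)%N) f i j).
  rewrite -big_split; apply: eq_bigr => i _ /=.
  rewrite (bigID (fun j : 'I_s => (i < j)%N)) /=; congr (_ + _).
  rewrite (bigID (fun j : 'I_s => (j < i)%N)) /= addrC big1 ?add0r.
    by apply: eq_bigl => j; case: ltngtP.
  move=> j; rewrite -!leqNgt -eqn_leq => /eqP ij.
  by have -> : i = j by apply/val_inj.
rewrite mulr2n; congr (_ + _).
rewrite (exchange_big_dep xpredT) //=; apply: eq_bigr => j _.
by apply: eq_bigr => i _.
Qed.

(** A polygonal equality is a zero of the form at the nonzero vector [e] with
   entries [m] on the points [a] and [- n] on the points [b]. *)
Lemma strict_negative_type_no_polygonal (R : realType) (X : metricType R)
    (p : R) :
  strict_negative_type X p -> ~ admits_polygonal_equality X p.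
Proof.
move=> [_ neg] [s [t [a [b [m [n]]]]]].
move=> [[s1 _] [ainj binj ab] [m0 _] emn eq_ab].
pose x (k : 'I_(s + t)) :=
  match fintype.split k with inl j => a j | inr i => b i end.
pose e (k : 'I_(s + t)) :=
  match fintype.split k with inl j => m j | inr i => - n i end.
have xl j : x (lshift t j) = a j by rewrite /x (unsplitK (inl j)).
have xr i : x (rshift s i) = b i by rewrite /x (unsplitK (inr i)).
have el j : e (lshift t j) = m j by rewrite /e (unsplitK (inl j)).
have er i : e (rshift s i) = - n i by rewrite /e (unsplitK (inr i)).
have xinj : injective x.
  move=> k l; rewrite -(splitK k) -(splitK l).
  case: (fintype.split k) => [j|i]; case: (fintype.split l) => [j'|i'] /=;
    rewrite ?xl ?xr => Ekl.
  - by rewrite (ainj _ _ Ekl).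
  - by have /eqP := ab j i'.
  - by have /eqP := ab j' i; rewrite Ekl.
  - by rewrite (binj _ _ Ekl).
have e0 : \sum_k e k = 0.
  rewrite big_split_ord /= (eq_bigr m) => [|j _]; last exact: el.
  rewrite [X in _ + X](eq_bigr (fun i => - n i)) => [|i _]; last exact: er.
  by rewrite sumrN emn subrr.
have [j1] : exists j, e j != 0.
  by exists (lshift t (Ordinal s1)); rewrite el gt_eqF.
move=> ej1; have := neg _ x e xinj e0 (ex_intro _ j1 ej1).
pose Sa := \sum_(j < s) \sum_(j' < s) m j * m j' * dist_pow p (a j) (a j').
pose Sb := \sum_(i < t) \sum_(i' < t) n i * n i' * dist_pow p (b i) (b i').
pose Sab := \sum_(j < s) \sum_(i < t) m j * n i * dist_pow p (a j) (b i).
have -> : \sum_k \sum_l dist_pow p (x k) (x l) * e k * e l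
    = Sa + Sb - Sab *+ 2.
  have -> : Sa + Sb - Sab *+ 2 = (Sa - Sab) + (Sb - Sab) by ring.
  rewrite big_split_ord /=; congr (_ + _).
    rewrite -sumrB; apply: eq_bigr => j _.
    rewrite big_split_ord -sumrN /=; congr (_ + _); apply: eq_bigr => i _.
      by rewrite !xl !el; ring.
    by rewrite xl xr el er; ring.
  rewrite /Sab /Sb [X in _ = _ - X]exchange_big -sumrB; apply: eq_bigr => i _.
  rewrite big_split_ord -sumrN addrC /=; congr (_ + _); apply: eq_bigr => j _.
    by rewrite xl xr el er dist_powC; ring.
  by rewrite !xr !er; ring.
have -> : Sab = _ := esym eq_ab.
rewrite /Sa /Sb !sum_sym_offdiag.
- by rewrite mulrnDl subrr ltxx.
- by move=> i i'; rewrite dist_powC mulrAC mulrC mulrA mulrAC.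
- by move=> i; rewrite dist_powxx mulr0.
- by move=> j j'; rewrite dist_powC mulrAC mulrC mulrA mulrAC.
- by move=> j; rewrite dist_powxx mulr0.
Qed.

(** * From the absence of polygonal equalities to ultrametric *)

Lemma geometric_dominates (R : realType) (c u v : R) :
  0 <= u -> u < v -> exists k : nat, c * u ^+ k < v ^+ k.
Proof.
move=> u0 uv; have v0 : 0 < v := le_lt_trans u0 uv.
have q1 : `|u / v| < 1.
  by rewrite ger0_norm ?divr_ge0 ?(ltW v0) // ltr_pdivrMr // mul1r.
have /cvgr_lt/(_ 1) : (c * (u / v) ^+ k @[k --> \oo] --> 0)%classic.
  by rewrite -(mulr0 c); apply: cvgMl_tmp; exact: cvg_expr.
move=> /(_ ltr01)[N _ /(_ N (leqnn N)) /= lt1]; exists N.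
by move: lt1; rewrite expr_div_n mulrA ltr_pdivrMr ?exprn_gt0 // mul1r.
Qed.

(** The difference of the two sides is a polynomial in [w], which is [- C < 0]
   at [w = 0] and [A / 4 - (B + C) / 2 > 0] at [w = 1 / 2]. *)
Lemma balancing_weight (R : rcfType) (A B C : R) :
  0 < C -> (B + C) *+ 2 < A ->
  exists2 w : R, 0 < w < 1 & w * (1 - w) * A = w * B + (1 - w) * C.
Proof.
move=> C0 ltA.
pose q : {poly R} := 'X * (1 - 'X) * A%:P - 'X * B%:P - (1 - 'X) * C%:P.
have qE w : q.[w] = w * (1 - w) * A - w * B - (1 - w) * C.
  by rewrite /q !hornerE.
have half0 : 0 <= 2^-1 :> R by rewrite invr_ge0 ler0n.
have [|w /andP[w0 w1] /rootP] := @poly_ivt R q 0 2^-1 half0.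
  by rewrite !qE; apply/andP; split; lra.
rewrite qE => rw; exists w; last by lra.
have : w != 0 by apply/eqP => w0E; move: rw; rewrite w0E; lra.
by rewrite neq_lt ltNge w0 /= => ->; lra.
Qed.

Lemma no_polygonal_ultrametric (R : realType) (X : metricType R) :
  (forall p : R, 0 <= p -> ~ admits_polygonal_equality X p) -> ultrametric X.
Proof.
move=> noeq x y z; rewrite leNgt; apply/negP; rewrite gt_max => /andP[xz yz].
have nxz : x != z by apply: contraTneq yz => ->; rewrite metric_sym ltxx.
have nyz : y != z by apply: contraTneq xz => ->; rewrite ltxx.
have nxy : x != y by rewrite -mdist_gt0 (le_lt_trans _ xz) ?mdist_ge0.
pose M := Num.max (mdist x z) (mdist y z).
(* [balancing_weight] requires twice the sum of two powers, each at most
   [M ^+ k], to be below [mdist x y ^+ k]: hence the constant 4. *)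
have [k ltk] : exists k : nat, 4 * M ^+ k < mdist x y ^+ k.
  apply: geometric_dominates; last by rewrite gt_max xz.
  by rewrite le_max mdist_ge0.
have leM u : 0 <= u -> u <= M -> u ^+ k <= M ^+ k.
  by move=> u0 uM; rewrite lerXn2r // nnegrE // (le_trans u0).
have [||w /andP[w0 w1] wE] :=
    @balancing_weight R (mdist x y ^+ k) (mdist x z ^+ k)
      (mdist y z ^+ k).
- by rewrite exprn_gt0 ?mdist_gt0.
- have := leM (mdist x z) (mdist_ge0 _ _).
  have := leM (mdist y z) (mdist_ge0 _ _).
  by rewrite !le_max !lexx orbT => /(_ isT) Cle /(_ isT) Ble; lra.
apply: (noeq k%:R) => //.
exists 1%N, 2%N, (fun=> z), (fun i => if i == 0 then x else y), (fun=> 1),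
  (fun i => if i == 0 then w else 1 - w); split=> //.
- split=> [i j _ | i j | j i].
  + by rewrite !ord1.
  + move: i j => [[|[|i]] // ?] [[|[|j]] // ?] /= E; try exact: val_inj.
    * by move: nxy; rewrite E eqxx.
    * by move: nxy; rewrite E eqxx.
  + by case: ifP => _; rewrite eq_sym.
- by split=> // i; case: ifP => _ //; rewrite subr_gt0.
- by rewrite !big_ord_recl !big_ord0 /=; ring.
- rewrite !big_ord_recl !big_ord0 ![\sum_(_ < _ | (_ < _)%N) _]big_mkcond /=.
  rewrite !big_ord_recl !big_ord0 /= (dist_powC _ z x) (dist_powC _ z y).
  rewrite !dist_powE // !powR_mulrn ?mdist_ge0 //; lra.
Qed.

Unset Implicit Arguments.

Theorem corollary5p3 (R : realType) (X : metricType R) :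
  [<-> ultrametric X;
       forall p : R, 0 <= p -> strict_negative_type X p;
       forall p : R, 0 <= p -> ~ admits_polygonal_equality X p].
Proof.
tfae.
- by move=> uX p; apply: ultrametric_strict_negative_type.
- by move=> neg p /neg; apply: strict_negative_type_no_polygonal.
- exact: no_polygonal_ultrametric.
Qed.
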